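(* Let $f:[a,b)\to\mathbb{R}$ be a $\Phi$-uniformly convex function, where $\Phi:[0,b-a)\to[0,\infty)$ is increasing with $\Phi(0)=0$. Let $\mathbf{p}=(p_1,\dots,p_n)$ and $\mathbf{q}=(q_1,\dots,q_n)$ be non-negative $n$-tuples with $\sum_{i=1}^{n}p_i=1$, $\sum_{i=1}^{n}q_i=1$ and $q_i>0$ for $i=1,\dots,n$, and let $m=\min_{1\le i\le n}\frac{p_i}{q_i}$. Let $\mathbf{x}=(x_1,\dots,x_n)\in[a,b)^n$ and let $k\in\{2,\dots,n\}$ be such that $$x_1\le x_2\le\dots\le x_{k-1}\le\sum_{i=1}^{n}q_ix_i\le x_k\le x_{k+1}\le\dots\le x_n.$$ Then $$J_n(f,\mathbf{x},\mathbf{p})-mJ_n(f,\mathbf{x},\mathbf{q})\ge\sum_{\substack{1\le i\le n-1\\ i\ne k-1}}(p_i-mq_i)(p_{i+1}-mq_{i+1})\Phi(x_{i+1}-x_i)$$ $$+\,m(p_{k-1}-mq_{k-1})\Phi\left(\sum_{i=1}^{n}q_ix_i-x_{k-1}\right)+m(p_k-mq_k)\Phi\left(x_k-\sum_{i=1}^{n}q_ix_i\right).$$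
   Context: The Jensen functional is $J_n(f,\mathbf{x},\mathbf{p})=\sum_{i=1}^{n}p_if(x_i)-f\left(\sum_{i=1}^{n}p_ix_i\right)$. A function $f:[a,b)\to\mathbb{R}$ is $\Phi$-uniformly convex, where $\Phi:[0,b-a)\to\mathbb{R}$ and $\Phi\ge 0$, if $tf(x)+(1-t)f(y)\ge f(tx+(1-t)y)+t(1-t)\Phi(|x-y|)$ for all $x,y\in[a,b)$ and $t\in[0,1]$. *)

(* Defs.v *)
From HB Require Import structures.
From mathcomp Require Import all_boot all_order all_algebra.
From mathcomp Require Import reals.

Set Implicit Arguments.
Unset Strict Implicit.
Unset Printing Implicit Defensive.

Import Order.TTheory GRing.Theory Num.Theory.
Local Open Scope ring_scope.

(* Tuples are indexed from 0: the entry x_i of the informal (x_1, ..., x_n)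
   is x`_i.-1. *)

Definition wmean (R : realType) (n : nat) (p x : n.-tuple R) : R :=
  \sum_(i < n) p`_i * x`_i.

Definition jensen_functional (R : realType) (n : nat)
    (f : R -> R) (x p : n.-tuple R) : R :=
  \sum_(i < n) p`_i * f x`_i - f (wmean p x).

(* f stands for a function on [a, b[ and Phi for a function on [0, b - a[:
   their values outside these intervals are unconstrained. *)
Definition uniformly_convex (R : realType) (a b : R) (Phi f : R -> R) : Prop :=
  {in `[0, b - a[, forall u, 0 <= Phi u} /\
  {in `[a, b[ &, forall x y, {in `[0, 1], forall t,
    t * f x + (1 - t) * f y >=
    f (t * x + (1 - t) * y) + t * (1 - t) * Phi `|x - y|}}.

(* The default value of the iterated minimum is the first ratio, so that this
   is the minimum of the ratios as soon as n > 0. *)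
Definition min_ratio (R : realType) (n : nat) (p q : n.-tuple R) : R :=
  \big[Num.min/(p`_0 / q`_0)]_(i < n) (p`_i / q`_i).

(* Main.v *)
(* Since m <= p_i / q_i, the left-hand side is the Jensen gap of the n + 1
   points obtained by inserting the q-mean of x, with weight m, among the x_i
   taken with weights p_i - m q_i.  For a sorted family the gap is at least the
   sum of w_j w_(j+1) Phi (y_(j+1) - y_j) over adjacent points: peel off the
   first point and compare it with the mean of the others, which lies to the
   right of the second point. *)

Require Import Defs.
From HB Require Import structures.
From mathcomp Require Import all_boot all_order all_algebra.
From mathcomp Require Import reals.
From mathcomp Require Import ring lra zify.

Set Implicit Arguments.
Unset Strict Implicit.
Unset Printing Implicit Defensive.

Import Order.TTheory GRing.Theory Num.Theory.
Local Open Scope ring_scope.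

Lemma nondecreasing_upto (R : realType) (y : nat -> R) (N : nat) :
  (forall i, (i < N)%N -> y i <= y i.+1) ->
  forall i, (i <= N)%N -> y 0%N <= y i.
Proof.
move=> hy; elim=> // i IH iN.
exact: le_trans (IH (ltnW iN)) (hy i iN).
Qed.

Section SortedJensen.
Variables (R : realType) (a b : R) (f Phi : R -> R).
Hypothesis hf : uniformly_convex a b Phi f.
Hypothesis hPhi : {in `[0, b - a[ &, {homo Phi : u v / u <= v}}.

(** Uniform convexity at [y1] and [z] yields the modulus [Phi (z - y1)], and monotonicity lowers it
    to the shorter gap [y2 - y1]. *)
Lemma uniformly_convex_monotone_modulus (t y1 y2 z : R) :
  0 <= t <= 1 -> a <= y1 -> y1 <= y2 -> y2 <= z -> z < b ->
  f (t * y1 + (1 - t) * z) + t * (1 - t) * Phi (y2 - y1) <=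
    t * f y1 + (1 - t) * f z.
Proof.
move=> /andP[t0 t1] ay1 y12 y2z zb; case: hf => _ conv.
have y1I : y1 \in `[a, b[ by rewrite in_itv /=; lra.
have zI : z \in `[a, b[ by rewrite in_itv /=; lra.
have tI : t \in `[0, 1] by rewrite in_itv /= t0 t1.
apply: le_trans (conv y1 z y1I zI t tI); rewrite lerD2l.
apply: ler_wpM2l; first by rewrite mulr_ge0 // subr_ge0.
rewrite distrC ger0_norm; last by lra.
by apply: hPhi; rewrite ?in_itv /=; lra.
Qed.

(** Induction on [N]. The points after the first get weights divided by their total [W], and the
    inductive bound times [W] is added to the convexity inequality between [y 0] and the tail mean
    [z]. With sequences on [nat], passing to the tail is a shift of index. *)
Lemma sorted_jensen_gap (N : nat) (w y : nat -> R) :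
  (forall i, (i <= N)%N -> 0 <= w i) ->
  \sum_(i < N.+1) w i = 1 ->
  (forall i, (i <= N)%N -> y i \in `[a, b[) ->
  (forall i, (i < N)%N -> y i <= y i.+1) ->
  \sum_(i < N) w i * w i.+1 * Phi (y i.+1 - y i) <=
    \sum_(i < N.+1) w i * f (y i) - f (\sum_(i < N.+1) w i * y i).
Proof.
elim: N w y => [|N IH] w y w0 w1 yI ys.
  move: w1; rewrite !big_ord1 big_ord0 => ->.
  by rewrite !mul1r subrr.
have recl (F : nat -> R) M :
    \sum_(i < M.+1) F i = F 0%N + \sum_(i < M) F i.+1 by rewrite big_ord_recl.
rewrite (recl (fun i => w i * w i.+1 * Phi (y i.+1 - y i))).
rewrite (recl (fun i => w i * f (y i))) (recl (fun i => w i * y i)).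
rewrite recl in w1.
set W := \sum_(i < N.+1) w i.+1 in w1.
have wS0 (i : 'I_N.+1) : 0 <= w i.+1 by apply: w0; rewrite ltnS -ltnS.
have W0 : 0 <= W by apply: sumr_ge0.
have w00 : 0 <= w 0%N by apply: w0.
have w10 : 0 <= w 1%N by apply: w0.
have w1W : w 1%N <= W.
  rewrite /W (recl (fun i => w i.+1)) lerDl.
  by apply: sumr_ge0 => i _; apply: w0; apply: ltn_ord.
(* If [W = 0] the tail cannot be renormalised, but all its weights vanish and both sides are 0. *)
have [WE0|WN0] := eqVneq W 0.
  have wE (i : nat) : (i <= N)%N -> w i.+1 = 0.
    move=> iN; move/eqP: WE0; rewrite psumr_eq0 //.
    by move=> /allP/(_ (inord i) (mem_index_enum _)); rewrite inordK // => /eqP.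
  have w0E : w 0%N = 1 by move: w1; rewrite WE0 addr0.
  rewrite !big1 => [|[i iN] _|[i iN] _|[i iN] _] /=;
    rewrite ?wE ?mul0r //; last exact: ltnW.
  by rewrite w0E mulr0 !mul0r !addr0 !mul1r subrr.
have Wgt0 : 0 < W by rewrite lt_def WN0.
pose v i := w i.+1 / W.
set z := (\sum_(i < N.+1) w i.+1 * y i.+1) / W.
have v1 : \sum_(i < N.+1) v i = 1 by rewrite -mulr_suml divff.
have yz : \sum_(i < N.+1) v i * y i.+1 = z.
  by rewrite /z mulr_suml; apply: eq_bigr => i _; rewrite /v mulrAC.
have v0 i : (i <= N)%N -> 0 <= v i.
  by move=> iN; rewrite divr_ge0 // w0.
have ySI i : (i <= N)%N -> y i.+1 \in `[a, b[ by move=> iN; apply: yI.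
have ySs i : (i < N)%N -> y i.+1 <= y i.+2 by move=> iN; apply: ys.
have := IH v (fun i => y i.+1) v0 v1 ySI ySs; rewrite yz.
have -> : \sum_(i < N.+1) v i * f (y i.+1) =
    (\sum_(i < N.+1) w i.+1 * f (y i.+1)) / W.
  by rewrite mulr_suml; apply: eq_bigr => i _; rewrite /v mulrAC.
have -> : \sum_(i < N) v i * v i.+1 * Phi (y i.+2 - y i.+1) =
    (\sum_(i < N) w i.+1 * w i.+2 * Phi (y i.+2 - y i.+1)) / W / W.
  by rewrite !mulr_suml; apply: eq_bigr => i _; rewrite /v; field.
set S := \sum_(i < N) _; set F := \sum_(i < N.+1) _ => tail.
have S0 : 0 <= S.
  apply: sumr_ge0 => -[i iN] _ /=; rewrite mulr_ge0 ?mulr_ge0 ?w0 //; first lia.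
  have := ySs i iN; have := ySI i.+1 iN; have := ySI i (ltnW iN).
  rewrite !in_itv /= => ? ? ?.
  by case: hf => + _; apply; rewrite in_itv /=; lra.
have y1z : y 1%N <= z.
  rewrite -yz -[X in X <= _]mul1r -v1 mulr_suml; apply: ler_sum => i _.
  apply: ler_wpM2l; first by apply: v0; rewrite -ltnS.
  by apply: (nondecreasing_upto (y := fun i => y i.+1) ySs); rewrite -ltnS.
(* The mean [z] is at most the last point, which is strictly below [b]. *)
have zb : z < b.
  have yN i : (i <= N)%N -> y i.+1 <= y N.+1.
    move=> iN; have := nondecreasing_upto (y := fun j => y (i + j).+1) (N := N - i).
    move=> /(_ _ (N - i)%N (leqnn _)); rewrite addn0 subnKC //; apply=> j ji.
    by rewrite addnS; apply: ySs; lia.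
  have : z <= y N.+1.
    rewrite -yz -[X in _ <= X]mul1r -v1 mulr_suml; apply: ler_sum => i _.
    by apply: ler_wpM2l; [apply: v0 | apply: yN]; rewrite -ltnS.
  by have := ySI N (leqnn N); rewrite in_itv /=; lra.
have ay0 : a <= y 0%N by have := yI 0%N isT; rewrite in_itv /=; lra.
have y01 : y 0%N <= y 1%N by apply: ys.
have t01 : 0 <= w 0%N <= 1 by lra.
have WE : 1 - w 0%N = W by lra.
(* With [t = w 0], the convex combination of [y 0] and [z] is the mean of the whole family. *)
have := uniformly_convex_monotone_modulus t01 ay0 y01 y1z zb.
rewrite WE {2}/z [W * (_ / W)]mulrC divfK // => head.
have P0 : 0 <= Phi (y 1%N - y 0%N).
  have := yI 1%N isT; rewrite in_itv /= => ?.
  by case: hf => + _; apply; rewrite in_itv /=; lra.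
have headW : w 0%N * w 1%N * Phi (y 1%N - y 0%N) <=
    w 0%N * W * Phi (y 1%N - y 0%N).
  by apply: ler_wpM2r => //; apply: ler_wpM2l.
(* Normalising divides products of two weights by [W] twice; multiplying back by [W] leaves [S / W],
   at least [S] because [W <= 1]. *)
have SW : S <= S / W by rewrite ler_pdivlMr // ler_piMr //; lra.
have tailW : S / W <= F - W * f z.
  by move: tail; rewrite ler_pdivrMr // mulrBl divfK // [f z * W]mulrC.
by lra.
Qed.

End SortedJensen.

Lemma min_ratio_le (R : realType) (n : nat) (p q : n.-tuple R) (i : 'I_n) :
  min_ratio p q <= p`_i / q`_i.
Proof. exact: bigmin_le_cond. Qed.

Lemma min_ratio_ge0 (R : realType) (n : nat) (p q : n.-tuple R) :
  (0 < n)%N -> (forall i : 'I_n, 0 <= p`_i) -> (forall i : 'I_n, 0 < q`_i) ->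
  0 <= min_ratio p q.
Proof.
move=> n0 hp hq; have r0 (i : 'I_n) : 0 <= p`_i / q`_i.
  by rewrite divr_ge0 // ltW.
rewrite /min_ratio; elim/big_ind: _ => // [|u v u0 v0].
  (* The default value of the minimum is the ratio at index 0, a genuine index as [0 < n]. *)
  exact: (r0 (Ordinal n0)).
by rewrite le_min u0.
Qed.

(** Entries from position [k] on move one place right. Since [bump k] enumerates the indices other
    than [k], its inverse [unbump k] recovers the original index. *)
Definition insert_at (T : Type) (k : nat) (c : T) (u : nat -> T) (i : nat) : T :=
  if i == k then c else u (unbump k i).

Lemma insert_at_bump (T : Type) (k : nat) (c : T) (u : nat -> T) (i : nat) :
  insert_at k c u (bump k i) = u i.
Proof. by rewrite /insert_at eq_sym (negbTE (neq_bump k i)) bumpK. Qed.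

Lemma insert_at_lt (T : Type) (k : nat) (c : T) (u : nat -> T) (i : nat) :
  (i < k)%N -> insert_at k c u i = u i.
Proof.
move=> ik; rewrite -[in LHS](_ : bump k i = i) ?insert_at_bump //.
by rewrite /bump leqNgt ik.
Qed.

Lemma insert_at_eq (T : Type) (k : nat) (c : T) (u : nat -> T) :
  insert_at k c u k = c.
Proof. by rewrite /insert_at eqxx. Qed.

Lemma insert_at_geS (T : Type) (k : nat) (c : T) (u : nat -> T) (i : nat) :
  (k <= i)%N -> insert_at k c u i.+1 = u i.
Proof.
move=> ki; rewrite -[in LHS](_ : bump k i = i.+1) ?insert_at_bump //.
by rewrite /bump ki.
Qed.

Lemma big_ord_bump (V : zmodType) (n k : nat) (G : nat -> V) : (k <= n)%N ->
  \sum_(i < n.+1) G i = G k + \sum_(i < n) G (bump k i).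
Proof. by move=> kn; rewrite (bigD1_ord (Ordinal (kn : (k < n.+1)%N))). Qed.

(* k is the 0-based position of the entry x_k of the informal statement: the
   informal x_(k-1) and x_k are x`_k.-1 and x`_k. *)
Theorem theorem8 (R : realType) (a b : R) (f Phi : R -> R)
    (hf : uniformly_convex a b Phi f)
    (hPhi : {in `[0, b - a[ &, {homo Phi : u v / u <= v}})
    (hPhi0 : Phi 0 = 0)
    (n : nat) (p q : n.-tuple R)
    (hp : forall i : 'I_n, 0 <= p`_i) (hp1 : \sum_(i < n) p`_i = 1)
    (hq : forall i : 'I_n, 0 < q`_i) (hq1 : \sum_(i < n) q`_i = 1)
    (m : R) (hm : m = min_ratio p q)
    (x : n.-tuple R) (hx : forall i : 'I_n, x`_i \in `[a, b[)
    (k : nat) (hk : (0 < k < n)%N)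
    (hxl : forall i : nat, (i.+1 < k)%N -> x`_i <= x`_i.+1)
    (hxk : x`_k.-1 <= wmean q x <= x`_k)
    (hxr : forall i : nat, (k <= i)%N -> (i.+1 < n)%N -> x`_i <= x`_i.+1) :
  jensen_functional f x p - m * jensen_functional f x q >=
    \sum_(i < n.-1 | i != k.-1 :> nat)
      (p`_i - m * q`_i) * (p`_i.+1 - m * q`_i.+1) * Phi (x`_i.+1 - x`_i)
    + m * (p`_k.-1 - m * q`_k.-1) * Phi (wmean q x - x`_k.-1)
    + m * (p`_k - m * q`_k) * Phi (x`_k - wmean q x).
Proof.
case/andP: hk => k0 kn; have n0 : (0 < n)%N by lia.
have m0 : 0 <= m by rewrite hm min_ratio_ge0.
pose d i := p`_i - m * q`_i.
have d0 i : (i < n)%N -> 0 <= d i.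
  move=> ltin; have := min_ratio_le p q (Ordinal ltin).
  by rewrite /= -hm ler_pdivlMr ?subr_ge0 //; apply: (hq (Ordinal ltin)).
have xI i : (i < n)%N -> x`_i \in `[a, b[.
  by move=> ltin; apply: (hx (Ordinal ltin)).
set c := wmean q x in hxk *.
pose w := insert_at k m d; pose y := insert_at k c (nth 0 x).
(* Taking [g] to be 1, the identity and [f] gives the total weight, the mean and the Jensen sum of
   the enlarged family. *)
have sumE (g : R -> R) : \sum_(i < n.+1) w i * g (y i) =
    m * g c + (\sum_(i < n) p`_i * g x`_i - m * \sum_(i < n) q`_i * g x`_i).
  rewrite (big_ord_bump (fun i => w i * g (y i)) (ltnW kn)).
  rewrite /w /y !insert_at_eq; congr (_ + _).
  rewrite mulr_sumr -sumrB; apply: eq_bigr => i _.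
  by rewrite !insert_at_bump /d mulrBl mulrA.
have w1 : \sum_(i < n.+1) w i = 1.
  have := sumE (fun=> 1); rewrite -!mulr_suml !mulr1 hp1 hq1 => ->.
  by rewrite mulr1 subrKC.
(* The inserted term [m * c] cancels [m] times the [q]-mean. *)
have wy : \sum_(i < n.+1) w i * y i = wmean p x.
  by rewrite (sumE id) -/(wmean p x) -/(wmean q x) -/c; ring.
have w0 i : (i <= n)%N -> 0 <= w i.
  rewrite /w; case: (ltngtP i k) => [ik _|ki|-> _].
  - by rewrite insert_at_lt // d0 //; lia.
  - by case: i ki => // i ki iN; rewrite insert_at_geS // d0.
  - by rewrite insert_at_eq.
have cI : c \in `[a, b[.
  have := xI k kn; have : x`_k.-1 \in `[a, b[ by apply: xI; lia.
  by rewrite !in_itv /=; lra.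
have yI i : (i <= n)%N -> y i \in `[a, b[.
  rewrite /y; case: (ltngtP i k) => [ik _|ki|-> _].
  - by rewrite insert_at_lt // xI //; lia.
  - by case: i ki => // i ki iN; rewrite insert_at_geS // xI.
  - by rewrite insert_at_eq.
have ys i : (i < n)%N -> y i <= y i.+1.
  rewrite /y; case: (ltngtP i k) => [ik _|ki|-> _].
  - rewrite insert_at_lt //; case: (ltngtP i.+1 k) => [ik1|ki1|ki1].
    + by rewrite insert_at_lt // hxl.
    + by lia.
    + by rewrite ki1 insert_at_eq; move: hxk; rewrite -ki1 => /andP[].
  - case: i ki => // i ki iN.
    by rewrite !insert_at_geS ?hxr //; lia.
  - by rewrite insert_at_eq insert_at_geS //; case/andP: hxk.
have := sorted_jensen_gap hf hPhi w0 w1 yI ys.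
rewrite wy (sumE f) /jensen_functional -/c.
(* The Jensen gap is already the left-hand side of the goal, the term [m * f c] coming from the
   [q]-functional; only the sum over adjacent points remains to be identified. *)
suff -> : \sum_(i < n) w i * w i.+1 * Phi (y i.+1 - y i) =
    \sum_(i < n.-1 | i != k.-1 :> nat)
      d i * d i.+1 * Phi (x`_i.+1 - x`_i)
    + m * d k.-1 * Phi (c - x`_k.-1) + m * d k * Phi (x`_k - c).
  by rewrite /d; lra.
have k1n : (k.-1 < n.-1)%N by lia.
rewrite -[in LHS](prednK n0).
have kn1 : (k <= n.-1)%N by lia.
(* The two gaps touching [c] are split off: first gap [k], on its right, then gap [k.-1], on its
   left. *)
rewrite (big_ord_bump (fun i => w i * w i.+1 * Phi (y i.+1 - y i)) kn1).
rewrite addrC (bigD1 (Ordinal k1n)) //= [X in X + _ = _]addrC.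
have -> : bump k k.-1 = k.-1 by rewrite /bump; lia.
rewrite prednK //.
rewrite /w /y !insert_at_eq !insert_at_geS // !insert_at_lt ?prednK //.
rewrite [d k.-1 * m]mulrC; congr (_ + _ + _).
apply: eq_big => // i ik; rewrite !insert_at_bump.
have {}ik : nat_of_ord i != k.-1 by exact: ik.
(* This fails only at [i = k.-1], the excluded index, where [c] separates the two neighbours. *)
have -> : (bump k i).+1 = bump k i.+1 by rewrite /bump; lia.
by rewrite !insert_at_bump.
Qed.
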